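(* Let $H$ be a covering $3$-hypergraph with at least two edges. Then $H$ is eulerian.
   Context: A hypergraph $H=(V,E)$ consists of a finite non-empty vertex set $V$ and a finite multiset $E$ of subsets of $V$, called edges (repeated edges allowed; distinct members of the multiset are distinct edges). $H$ is $3$-uniform if every edge has exactly 3 elements. A walk is a sequence $v_0e_1v_1\dots e_mv_m$ with $v_i\in V$, $e_i\in E$, $v_{i-1},v_i\in e_i$, $v_{i-1}\neq v_i$; it is a trail if the $e_i$ are pairwise distinct, and closed if $v_0=v_m$ and $m\ge 2$. An Euler tour is a closed trail traversing every edge exactly once; $H$ is eulerian if it has no edges or admits an Euler tour. A covering $3$-hypergraph is a $3$-uniform hypergraph with at least one edge in which every pair of distinct vertices is contained in at least one edge. *)

(* Defs.v *)
From HB Require Import structures.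
From mathcomp Require Import all_boot.

Set Implicit Arguments.
Unset Strict Implicit.
Unset Printing Implicit Defensive.

(* The multiset of edges is an indexed family: [edge H] is the finite type of
   its members, and [inc e] is the vertex set underlying the member [e], so
   parallel edges are distinct elements of [edge H] with the same [inc]. *)
Record hypergraph := Hypergraph {
  vertex : finType;
  edge : finType;
  inc : edge -> {set vertex};
  vertex_nonempty : 0 < #|vertex|
}.

Definition uniform3 (H : hypergraph) : Prop :=
  forall e : edge H, #|inc e| = 3.

Definition covering3 (H : hypergraph) : Prop :=
  [/\ uniform3 H,
      0 < #|edge H|
    & forall u v : vertex H, u != v -> exists e : edge H, u \in inc e /\ v \in inc e].

(* The sequence v0 e1 v1 ... em vm is represented by the vertex v0 together
   with the list [:: (e1, v1); ...; (em, vm)]. *)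
Fixpoint walk (H : hypergraph) (v : vertex H) (s : seq (edge H * vertex H)) : bool :=
  if s is (e, w) :: s' then
    [&& v \in inc e, w \in inc e, v != w & walk w s']
  else true.

Definition trail (H : hypergraph) (v : vertex H) (s : seq (edge H * vertex H)) : bool :=
  walk v s && uniq (unzip1 s).

Definition closed_walk (H : hypergraph) (v : vertex H) (s : seq (edge H * vertex H)) : bool :=
  [&& walk v s, last v (unzip2 s) == v & 2 <= size s].

Definition euler_tour (H : hypergraph) (v : vertex H) (s : seq (edge H * vertex H)) : Prop :=
  [/\ trail v s, closed_walk v s & forall e : edge H, count_mem e (unzip1 s) = 1].

Definition eulerian (H : hypergraph) : Prop :=
  #|edge H| = 0 \/ exists (v : vertex H) (s : seq (edge H * vertex H)), euler_tour v s.

(* Main.v *)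
Require Import Defs.
From HB Require Import structures.
From mathcomp Require Import all_boot.

Set Implicit Arguments.
Unset Strict Implicit.
Unset Printing Implicit Defensive.

(* A tour passes each edge e through two of its three vertices, so it amounts to
   a choice f of one omitted vertex per edge such that the multigraph G_f with
   edges e \ f e is even and has all its edges in one component.

   Parity: a "rainbow" spanning tree, using at most one pair of vertices from
   each edge, lets one correct the parity of f leaf by leaf. To see that it
   exists, take a partial rainbow tree that cannot be extended. Its last edge is
   {x, y, w}, where x is the last vertex, y its parent and w the only missing
   vertex; x and w play symmetric roles, so a leaf u <> y of the rest of the tree
   would need its only tree edge to contain both x and w.

   Connectivity: let B be a component of G_f and let some edge of G_f avoid B.
   Since the pairs between B and its complement are covered, moving the omitted
   vertex along a suitable closed cycle of such pairs keeps all degrees even and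
   produces a component larger than B. Even graphs have no bridges, so B survives
   the loss of one of its edges; this settles all but a few configurations, which
   are handled by choosing a non-cut vertex of B or by comparing two switches. *)

(** * Omitted vertices, degree parities and cuts *)

Lemma xor_pred1 (T : finType) (Z : {set T}) (p : T) :
  \big[addb/false]_(x in Z) (x == p) = (p \in Z).
Proof.
rewrite big_mkcond (bigD1 p) //= big1 ?addbF; last first.
  by move=> x /negbTE ->; case: ifP.
by rewrite eqxx; case: ifP.
Qed.

Section Omission.

Variable H : hypergraph.
Hypothesis uniH : uniform3 H.

Implicit Types (e : edge H) (p q r x : vertex H) (Z : {set vertex H}).
Implicit Types (f : edge H -> vertex H).

Lemma third_vertex e p q : p \in inc e -> q \in inc e -> p != q ->
  exists r, [/\ r != p, r != q & forall x, (x \in inc e) = [|| x == p, x == q | x == r]].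
Proof.
move=> pe qe pq.
have /eqP/cards1P[r Hr] : #|(inc e :\ p) :\ q| = 1.
  have := cardsD1 p (inc e); rewrite pe uniH => /= [[]].
  have := cardsD1 q (inc e :\ p); rewrite !inE qe eq_sym pq /= => ->.
  by case.
have := set11 r; rewrite -Hr !inE => /and3P[rq rp re].
exists r; split=> // x; have := in_set1 x r; rewrite -Hr !inE => <-.
by case: eqP => [->|_] //=; case: eqP => [->|_].
Qed.

Lemma three_vertices e p q r x : p \in inc e -> q \in inc e -> r \in inc e ->
  p != q -> p != r -> q != r -> (x \in inc e) = [|| x == p, x == q | x == r].
Proof.
move=> pe qe re pq pr qr; have [s [_ _ Hs]] := third_vertex pe qe pq.
move: (re); rewrite Hs eq_sym (negbTE pr) eq_sym (negbTE qr) /= => /eqP ->.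
exact: Hs.
Qed.

(* A map [f] picking a vertex of every edge encodes the choice of the two
   vertices through which a tour passes that edge: the ones different from
   [f e]. The resulting multigraph on the vertices has edges [ends f e]. *)
Definition omission f : Prop := forall e, f e \in inc e.

Definition ends f e x := (x \in inc e) && (x != f e).

Definition joins f e p q : Prop :=
  p != q /\ forall x, ends f e x = (x == p) || (x == q).

Definition odd_deg f x := \big[addb/false]_e ends f e x.

Definition even_omission f : Prop := omission f /\ forall x, odd_deg f x = false.

Lemma joins_sym f e p q : joins f e p q -> joins f e q p.
Proof. by case=> pq Hx; split=> [|x]; [rewrite eq_sym | rewrite Hx orbC]. Qed.

Lemma joins_omit f e p q r : p \in inc e -> q \in inc e -> p != q -> f e = r ->
  r \in inc e -> r != p -> r != q -> joins f e p q.
Proof.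
move=> pe qe pq fr re rp rq; split=> // x; rewrite /ends fr.
rewrite (three_vertices x pe qe re pq) 1?(eq_sym _ r) //.
case: (eqVneq x r) => [->|]; last by rewrite orbF andbT.
by rewrite andbF (negbTE rp) (negbTE rq).
Qed.

Lemma ends_joins f e p : omission f -> ends f e p -> exists q, joins f e p q.
Proof.
move=> om /andP[pe pf]; have [q [qp qf Hq]] := third_vertex pe (om e) pf.
exists q; apply: (@joins_omit _ _ _ _ (f e)) => //; rewrite ?Hq ?eqxx ?orbT //.
all: by rewrite eq_sym.
Qed.

Lemma omission_joins f e : omission f -> exists p q, joins f e p q.
Proof.
move=> om; have /card_gt0P[p] : 0 < #|inc e :\ f e|.
  by have := cardsD1 (f e) (inc e); rewrite om uniH add1n => -[<-].
rewrite !inE andbC => /(ends_joins om)[q pq]; by exists p, q.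
Qed.

Lemma joinsI f e p q : omission f -> ends f e p -> ends f e q -> p != q ->
  joins f e p q.
Proof.
move=> om /(ends_joins om)[r [pr Hr]]; rewrite Hr eq_sym => /orP[/eqP->|/eqP->].
  by rewrite eqxx.
by [].
Qed.

Lemma joins_endl f e p q : joins f e p q -> ends f e p.
Proof. by case=> _ ->; rewrite eqxx. Qed.

Lemma joins_endr f e p q : joins f e p q -> ends f e q.
Proof. by case=> _ ->; rewrite eqxx orbT. Qed.

(** For an omission [f] this tells whether the pair kept by [e] crosses the boundary of [Z].
    Counting ends modulo 2 turns the sum over all edges into an exchange of summations. *)
Definition cut f e Z := \big[addb/false]_(x in Z) ends f e x.

Lemma cutE f e p q Z : joins f e p q -> cut f e Z = (p \in Z) (+) (q \in Z).
Proof.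
case=> pq Hx; rewrite -!xor_pred1 -big_split /=; apply: eq_bigr => x _.
by rewrite Hx; case: (eqVneq x p) => [->|]; rewrite ?(negbTE pq).
Qed.

Lemma cut_sum f Z :
  \big[addb/false]_e cut f e Z = \big[addb/false]_(x in Z) odd_deg f x.
Proof. by rewrite exchange_big. Qed.

Lemma cut_sum0 f Z : even_omission f -> \big[addb/false]_e cut f e Z = false.
Proof. by case=> _ ev; rewrite cut_sum big1. Qed.

(** In an even graph an even number of edges leaves any vertex set, so no edge leaves it alone:
    there are no bridges. *)
Lemma cut_uniq f Z h : even_omission f ->
  (forall e, e != h -> cut f e Z = false) -> cut f h Z = false.
Proof.
move=> ev Hc; have := cut_sum0 Z ev; rewrite (bigD1 h) //= big1 ?addbF //.
Qed.

(** The same count with two candidates: both cross the boundary or neither does. *)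
Lemma cut_pair f Z h w : even_omission f -> h != w ->
  (forall e, e != h -> e != w -> cut f e Z = false) -> cut f h Z = cut f w Z.
Proof.
move=> ev hw Hc; have := cut_sum0 Z ev; rewrite (bigD1 h) //= (bigD1 w) 1?eq_sym //=.
rewrite big1 ?addbF; first by case: (cut _ _ _); case: (cut _ _ _).
by move=> e /andP[? ?]; apply: Hc.
Qed.

(** * Moving omitted vertices *)

Definition switch p q x := if x == p then q else p.

(** Under this condition [switch p q] exchanges [p] and [q] as omitted vertex of [e]; its default
    branch is then only met at [q]. *)
Definition switchable f (t : edge H * vertex H * vertex H) :=
  let: (e, p, q) := t in
  [&& p \in inc e, q \in inc e, p != q & (f e == p) || (f e == q)].

Fixpoint switches f (s : seq (edge H * vertex H * vertex H)) e :=
  if s is (e1, p, q) :: s' then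
    if e == e1 then switch p q (f e) else switches f s' e
  else f e.

Definition edges (s : seq (edge H * vertex H * vertex H)) := [seq t.1.1 | t <- s].

Lemma switches_notin f s e : e \notin edges s -> switches f s e = f e.
Proof.
elim: s => [|[[e1 p] q] s IHs] //=.
by rewrite inE negb_or => /andP[/negbTE-> /IHs].
Qed.

Lemma switches_omission f s : omission f -> all (switchable f) s ->
  omission (switches f s).
Proof.
move=> om; elim: s => [|[[e1 p] q] s IHs] //= /andP[/and4P[pe qe _ _] Hs] e.
case: eqP => [->|_]; last exact: IHs.
by rewrite /switch; case: ifP.
Qed.

(** The third vertex of an edge is kept before and after, so a switch between [p] and [q] flips the
    degree parities of just these two. Modulo 2 it acts like adding an edge [pq]; hence closed
    cycles of switches preserve evenness. *)
Lemma switches_odd_deg f s x : uniq (edges s) -> all (switchable f) s ->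
  odd_deg (switches f s) x =
    odd_deg f x (+) \big[addb/false]_(t <- s) ((x == t.1.2) (+) (x == t.2)).
Proof.
elim: s => [|[[e p] q] s IHs] /=; first by rewrite big_nil addbF.
move=> /andP[es us] /andP[/and4P[pe qe pq fe] Hs].
rewrite big_cons /= addbCA -(IHs us Hs) /odd_deg !(bigD1 e (P := predT)) //=.
rewrite addbA; congr (_ (+) _); last first.
  by apply: eq_bigr => e' /negbTE ne; rewrite /ends /= ne.
rewrite /ends /= eqxx switches_notin // /switch.
case/orP: fe => /eqP->; rewrite ?eqxx.
  case: (eqVneq x p) => [->|]; first by rewrite pe pq (negbTE pq).
  by case: (eqVneq x q) => [->|]; rewrite ?qe // andbT /=; case: (_ \in _).
rewrite (eq_sym q p) (negbTE pq).
case: (eqVneq x p) => [->|]; first by rewrite pe pq (negbTE pq).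
by case: (eqVneq x q) => [->|]; rewrite ?qe // andbT /=; case: (_ \in _).
Qed.

Lemma switches_even f s : even_omission f -> uniq (edges s) ->
  all (switchable f) s ->
  (forall x, \big[addb/false]_(t <- s) ((x == t.1.2) (+) (x == t.2)) = false) ->
  even_omission (switches f s).
Proof.
case=> om ev us sw Hx; split; first exact: switches_omission.
by move=> x; rewrite switches_odd_deg // ev Hx.
Qed.

End Omission.

(** * Rainbow spanning trees and parity *)

Section RainbowTree.

Variable H : hypergraph.
Hypothesis uniH : uniform3 H.

Implicit Types (e : edge H) (p q r u v w x y : vertex H).
Implicit Types (f : edge H -> vertex H) (s : seq (edge H * vertex H * vertex H)).

Definition verts r s := r :: [seq t.1.2 | t <- s].

(* A triple [(e, v, p)] attaches the new vertex [v] to the earlier vertex [p]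
   through the unused edge [e]; the head of the list is the last attachment. *)
Fixpoint rainbow_tree r s :=
  if s is (e, v, p) :: s' then
    [&& v \in inc e, p \in inc e, p \in verts r s', v \notin verts r s',
        e \notin edges s' & rainbow_tree r s']
  else true.

Lemma rainbow_tree_mem r s e v p : rainbow_tree r s -> (e, v, p) \in s ->
  [/\ v \in inc e, p \in inc e, v != p, v \in verts r s & p \in verts r s].
Proof.
elim: s => [|[[e1 v1] p1] s IHs] //= /and5P[ve pe pv vv /andP[_ ts]].
rewrite inE => /orP[/eqP[-> -> ->]|ins].
  split=> //; rewrite ?inE ?eqxx ?orbT //.
    by apply: contraNneq vv => ->.
  by move: pv; rewrite inE => /orP[] ->; rewrite ?orbT.
have [? ? ? V P] := IHs ts ins; split=> //.
  by move: V; rewrite !inE => /orP[] ->; rewrite ?orbT.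
by move: P; rewrite !inE => /orP[] ->; rewrite ?orbT.
Qed.

(** A tree with an edge has two leaves, so one differs from [y]. The last vertex [v] is a leaf; if
    it is [y], take a leaf of the remaining tree other than the parent of [v], or that parent itself
    when nothing else remains. *)
Lemma rainbow_tree_leaf r s y : rainbow_tree r s -> s != [::] ->
  exists2 u, (u \in verts r s) && (u != y) &
  exists eu, forall e v p, (e, v, p) \in s -> (u == v) || (u == p) -> e = eu.
Proof.
elim: s y => [|[[e v] p] s IHs] y //= /and5P[ve pe pv vv /andP[_ ts]] _.
have [vy|vy] := eqVneq v y; last first.
  exists v; first by rewrite vy !inE eqxx orbT.
  exists e => e1 v1 p1; rewrite inE => /orP[/eqP[->]//|ins].
  have [_ _ _ V P] := rainbow_tree_mem ts ins.
  by case/orP => /eqP vE; rewrite vE ?V ?P in vv.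
have [s0|sN] := eqVneq s [::].
  exists p.
    rewrite -vy; move: pv vv; rewrite s0 /verts /= !inE => /eqP -> /=.
    by rewrite eqxx eq_sym.
  by exists e => e1 v1 p1; rewrite s0 inE => /eqP[->].
have [u /andP[uv up] [eu Hu]] := IHs p ts sN.
have uNv : u != v by apply: contraNneq vv => <-.
exists u.
  rewrite -vy uNv andbT; move: uv; rewrite !inE => /orP[] ->; by rewrite ?orbT.
exists eu => e1 v1 p1; rewrite inE => /orP[/eqP[-> -> ->]|]; last exact: Hu.
by rewrite (negbTE up) (negbTE uNv).
Qed.

Definition extendible r s := [exists e, exists w, exists p,
  [&& w \in inc e, p \in inc e, p \in verts r s, w \notin verts r s & e \notin edges s]].

Lemma extendible_tree r s : rainbow_tree r s -> extendible r s ->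
  exists2 s', rainbow_tree r s' & size s' = (size s).+1.
Proof.
move=> ts /existsP[e /existsP[w /existsP[p /and5P[we pe pv wv es]]]].
by exists ((e, w, p) :: s); rewrite //= we pe pv wv es.
Qed.

Lemma not_extendible r s e w p : ~~ extendible r s -> w \in inc e -> p \in inc e ->
  p \in verts r s -> w \notin verts r s -> e \in edges s.
Proof.
move=> N we pe pv wv; apply/negPn/negP => es; case/negP: N.
by apply/existsP; exists e; apply/existsP; exists w; apply/existsP; exists p; apply/and5P.
Qed.

Lemma four_vertices e p q u w : p \in inc e -> q \in inc e -> u \in inc e -> w \in inc e ->
  p != q -> p != u -> p != w -> q != u -> q != w -> u != w -> False.
Proof.
move=> pe qe ue we pq pu pw qu qw uw; move: we.
rewrite (three_vertices uniH w pe qe ue pq pu qu).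
by rewrite eq_sym (negbTE pw) eq_sym (negbTE qw) eq_sym (negbTE uw).
Qed.

Hypothesis covH : forall u v : vertex H, u != v -> exists e, u \in inc e /\ v \in inc e.
Hypothesis edge_ge2 : 2 <= #|edge H|.

Lemma rainbow_tree_grow r s w : rainbow_tree r s -> w \notin verts r s ->
  exists2 s', rainbow_tree r s' & size s' = (size s).+1.
Proof.
case: s => [|[[e0 x] y] s].
  move=> _; rewrite inE => wr; have [e [we re]] := covH wr.
  by exists [:: (e, w, r)]; rewrite //= we re !inE eqxx wr.
move=> ts wv; have [ext|N] := boolP (extendible r ((e0, x, y) :: s)).
  exact: extendible_tree ext.
have /= /and5P[xe ye yv xv /andP[e0s ts']] := ts.
have [wr wx ws] : [/\ w != r, w != x & w \notin verts r s].
  by move: wv; rewrite !inE !negb_or => /and3P[-> -> ->].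
have xy : x != y by apply: contraNneq xv => ->.
have wy : w != y by apply: contraNneq ws => ->.
have xin : x \in verts r ((e0, x, y) :: s) by rewrite !inE eqxx orbT.
have sub u : u \in verts r s -> u \in verts r ((e0, x, y) :: s).
  by rewrite !inE => /orP[] ->; rewrite ?orbT.
(* A tree edge of [s] already contains two vertices of the tree, which leaves room for only one
   vertex outside. *)
have far e u : e \in edges s -> u \in inc e -> u \notin verts r s ->
    forall z, z \in inc e -> z \notin verts r s -> z = u.
  case/mapP=> -[[e1 v1] p1] /= ins -> ue uv z ze zv; apply/eqP/negPn/negP => zu.
  have [? ? ? V P] := rainbow_tree_mem ts' ins.
  by apply: (@four_vertices e1 v1 p1 u z) => //;
    [apply: contraNneq uv => <- | apply: contraNneq zv => <-
    |apply: contraNneq uv => <- | apply: contraNneq zv => <- | rewrite eq_sym].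
(* The edge covering [w] and [x] must be used, and by [far] it is not in [s]. *)
have we : w \in inc e0.
  have [e [We Xe]] := covH wx.
  have := not_extendible N We Xe xin wv; rewrite inE => /orP[/eqP /= <- //|es].
  by move: wx; rewrite (far e x es Xe xv w We ws) eqxx.
have only z : (z \in inc e0) = [|| z == x, z == y | z == w].
  by apply: (three_vertices uniH) => //; rewrite eq_sym.
have ts2 : rainbow_tree r ((e0, w, y) :: s) by rewrite /= we ye yv ws e0s.
have [ext|N2] := boolP (extendible r ((e0, w, y) :: s)).
  exact: extendible_tree ts2 ext.
(* If [e0] is the only tree edge, being stuck forces all vertices into [e0]. Any second edge then
   has the same three vertices and extends the tree. *)
have [s0|sN] := eqVneq s [::].
  have [e1 e10] : exists e1, e1 != e0.
    case: (pickP (fun e1 => e1 != e0)) => [e1 ?|P0]; first by exists e1.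
    have : #|edge H| <= 1.
      rewrite -(cards1 e0) -cardsT; apply/subset_leq_card/subsetP => e1 _.
      by rewrite inE; have := P0 e1; case: eqP.
    by rewrite leqNgt edge_ge2.
  have cover z : z \in [:: r; x; w].
    apply/negPn/negP; rewrite !inE !negb_or => /and3P[zr zx zw].
    have zv : z \notin verts r ((e0, x, y) :: s) by rewrite s0 !inE (negbTE zr) (negbTE zx).
    have [e [Ze Xe]] := covH zx.
    have := not_extendible N Ze Xe xin zv; rewrite s0 inE => /eqP /= ee.
    move: Ze; rewrite ee only (negbTE zx) (negbTE zw) /=.
    by move: yv; rewrite s0 inE => /eqP ->; rewrite (negbTE zr).
  have yr : y = r by move: yv; rewrite s0 inE => /eqP.
  have all_in z : z \in inc e1.
    have : inc e1 \subset inc e0.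
      apply/subsetP => t _; rewrite only yr; have := cover t.
      by rewrite !inE orbCA.
    move=> sb; have /eqP -> : inc e1 == inc e0 by rewrite eqEcard sb !uniH.
    by rewrite only yr; have := cover z; rewrite !inE orbCA.
  have := not_extendible N (all_in w) (all_in x) xin wv.
  by rewrite s0 inE (negbTE e10).
have [u /andP[uv uy] [eu Hu]] := rainbow_tree_leaf y ts' sN.
(* The edge covering the leaf [u] and the outside vertex [z] is used and is not [e0]. Besides [z] it
   has only its two tree vertices, so [u] is one of them and the edge is [eu]. *)
have hits z s1 : z \notin verts r s -> z \in inc e0 -> edges s1 = e0 :: edges s ->
    ~~ extendible r s1 -> u \in verts r s1 -> z \notin verts r s1 ->
    exists v p, (eu, v, p) \in s /\ z \in inc eu.
  move=> zv ze Es1 N1 us1 zs1.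
  have uz : u != z by apply: contraNneq zv => <-.
  have [e [Ue Ze]] := covH uz.
  have := not_extendible N1 Ze Ue us1 zs1; rewrite Es1 inE => /orP[/eqP ee|].
    move: Ue; rewrite ee only (negbTE uy) => /orP[|] /eqP uE.
      by rewrite -uE uv in xv.
    by rewrite -uE uv in ws.
  case/mapP=> -[[e1 v1] p1] /= ins ee; rewrite {e}ee in Ue Ze.
  have [Ve Pe vp V P] := rainbow_tree_mem ts' ins.
  have uvp : (u == v1) || (u == p1).
    apply/negPn/negP; rewrite negb_or => /andP[uv1 up1].
    by apply: (@four_vertices e1 v1 p1 u z) => //; rewrite 1?eq_sym //;
      [apply: contraNneq zv => -> | apply: contraNneq zv => ->].
  have E1 := Hu _ _ _ ins uvp.
  by exists v1, p1; rewrite -E1.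
have [v1 [p1 [ins weu]]] : exists v p, (eu, v, p) \in s /\ w \in inc eu.
  by apply: (hits w ((e0, x, y) :: s)) => //; apply: sub.
have [_ [_ [_ xeu]]] : exists v p, (eu, v, p) \in s /\ x \in inc eu.
  apply: (hits x ((e0, w, y) :: s)) => //.
    by move: uv; rewrite !inE => /orP[] ->; rewrite ?orbT.
  by move: xv; rewrite !inE !negb_or => /andP[-> ->]; rewrite eq_sym wx.
have es : eu \in edges s by apply/mapP; exists (eu, v1, p1).
by move: wx; rewrite (far eu x es xeu xv w weu ws) eqxx.
Qed.

Lemma rainbow_spanning_tree r : exists2 s, rainbow_tree r s & forall x, x \in verts r s.
Proof.
have bound s : rainbow_tree r s -> uniq (verts r s).
  elim: s => [|[[e v] p] s IHs] //= /and5P[_ _ _ vv /andP[_ ts]].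
  move: vv (IHs ts); rewrite !inE !negb_or => /andP[vr vs] /= /andP[rs us].
  by rewrite eq_sym vr rs vs us.
(* Here [n] bounds the number of further extensions; the tree cannot have more vertices than [H]. *)
suff grow n s : rainbow_tree r s -> #|vertex H| <= size s + n ->
    exists2 s, rainbow_tree r s & forall x, x \in verts r s.
  by apply: (grow #|vertex H| [::]) => //; rewrite leq_addl.
elim: n s => [|n IHn] s ts le.
  have := max_card (mem (verts r s)); rewrite (card_uniqP (bound s ts)) /= size_map.
  by move=> /leq_trans/(_ le); rewrite addn0 ltnn.
have [/existsP[w wv]|] := boolP [exists w, w \notin verts r s].
  have [s' ts' sz] := rainbow_tree_grow ts wv.
  by apply: (IHn s' ts'); rewrite sz addSn -addnS.
by rewrite negb_exists => /forallP Hx; exists s => // x; have := Hx x; rewrite negbK.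
Qed.

Lemma rainbow_tree_omission r s : rainbow_tree r s ->
  exists2 f, omission f & forall e v p, (e, v, p) \in s -> f e = v.
Proof.
elim: s => [|[[e v] p] s IHs] /=.
  move=> _; have ex e : exists x, x \in inc e.
    by apply/set0Pn; rewrite -card_gt0 uniH.
  by exists (fun e => xchoose (ex e)) => // e; apply: xchooseP.
move=> /and5P[ve pe _ _ /andP[es ts]]; have [f om Hf] := IHs ts.
exists (fun e' => if e' == e then v else f e').
  by move=> e'; case: eqP => [->|_].
move=> e1 v1 p1; rewrite inE => /orP[/eqP[-> -> _]|ins]; first by rewrite eqxx.
case: eqP => [E1|_]; last exact: Hf ins.
by case/negP: es; apply/mapP; exists (e1, v1, p1).
Qed.

(** Vertices are corrected from the last attached one down: switching the edge of [v] fixes [v] and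
    passes the defect to its parent. The remaining tree does not contain [v], so later switches
    leave its parity alone. *)
Lemma rainbow_tree_even r s f : rainbow_tree r s -> omission f ->
  (forall e v p, (e, v, p) \in s -> (f e == v) || (f e == p)) ->
  exists2 f', omission f' &
    (forall x, x \notin verts r s -> odd_deg f' x = odd_deg f x) /\
    (forall x, x \in verts r s -> x != r -> odd_deg f' x = false).
Proof.
elim: s f => [|[[e v] p] s IHs] f /=.
  move=> _ om _; exists f => //; split=> // x.
  by rewrite inE => ->.
move=> /and5P[ve pe pv vv /andP[es ts]] om Hf.
have vp : v != p by apply: contraNneq vv => ->.
have [f1 [om1 Hf1 d1 dv]] : exists f1, [/\ omission f1,
    forall e1 v1 p1, (e1, v1, p1) \in s -> (f1 e1 == v1) || (f1 e1 == p1),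
    forall x, x \notin verts r ((e, v, p) :: s) -> odd_deg f1 x = odd_deg f x
    & odd_deg f1 v = false].
  have Hs e1 v1 p1 : (e1, v1, p1) \in s -> (f e1 == v1) || (f e1 == p1).
    by move=> ins; apply: Hf; rewrite inE ins orbT.
  case dv: (odd_deg f v); last by exists f.
  have sw : all (switchable f) [:: (e, v, p)].
    by rewrite /= ve pe vp Hf ?inE ?eqxx.
  exists (switches f [:: (e, v, p)]); split.
  - exact: switches_omission.
  - move=> e1 v1 p1 ins; rewrite switches_notin; first exact: Hs.
    rewrite inE /=; apply: contraNneq es => <-; apply/mapP; by exists (e1, v1, p1).
  - move=> x xv; rewrite switches_odd_deg // big_seq1 /=.
    move: xv; rewrite !inE !negb_or => /and3P[xr /negbTE-> xs].
    rewrite (_ : x == p = false) ?addbF //; apply: contraNF xs => /eqP xp.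
    by move: pv; rewrite inE -xp (negbTE xr).
  - by rewrite switches_odd_deg // big_seq1 /= dv eqxx (negbTE vp).
have [f' om' [out inn]] := IHs f1 ts om1 Hf1.
exists f' => //; split=> x.
  move=> xv; rewrite out; first exact: d1.
  by move: xv; rewrite !inE !negb_or => /and3P[-> _ ->].
rewrite !inE => /or3P[/eqP->|/eqP->|xs] xr; first by rewrite eqxx in xr.
  by rewrite out.
by apply: inn => //; rewrite inE xs orbT.
Qed.

Lemma even_omission_exists : exists f : edge H -> vertex H, even_omission f.
Proof.
have /card_gt0P[r _] := vertex_nonempty H.
have [s ts span] := rainbow_spanning_tree r.
have [f0 om0 Hf0] := rainbow_tree_omission ts.
have [|f om [_ Hf]] := rainbow_tree_even ts om0.
  by move=> e v p /Hf0 ->; rewrite eqxx.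
exists f; split=> // x; have [->|xr] := eqVneq x r; last exact: Hf.
(* The root is even by the handshake lemma: every edge contributes two ends. *)
have := cut_sum f setT; rewrite [RHS](bigD1 r) ?inE //= [X in _ (+) X]big1 ?addbF.
  move=> <-; apply: big1 => e _; have [p [q pq]] := omission_joins uniH e om.
  by rewrite (cutE _ pq) !inE.
by move=> y /andP[_ yr]; apply: Hf.
Qed.

End RainbowTree.

(** * Enlarging a component *)

(** A connected set containing [r] is grown one vertex at a time until a single vertex [b] of the
    component is missing; so removing [b] leaves the rest connected. *)
Lemma noncut_vertex (T : finType) (E : rel T) (r : T) :
  1 < #|[set x | connect E r x]| ->
  exists2 b, connect E r b & exists2 r0, connect E r r0 & forall x, connect E r x -> x != b ->
    connect [rel u v | [&& E u v, connect E r u, connect E r v, u != b & v != b]] r0 x.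
Proof.
set B := [set x | _] => B2.
have rB : r \in B by rewrite inE.
have grow n : n < #|B| -> exists2 S : {set T}, (S \subset B) && (#|S| == n.+1) &
    forall x, x \in S -> connect [rel u v | [&& E u v, u \in S & v \in S]] r x.
  elim: n => [|n IHn] nB.
    by exists [set r] => [|x]; rewrite ?sub1set ?rB ?cards1 // inE => /eqP->.
  have [S /andP[SB /eqP cS] HS] := IHn (ltnW nB).
  have rS : r \in S.
    have /card_gt0P[x xS] : 0 < #|S| by rewrite cS.
    have /connectP[[|y p] /= pth xE] := HS x xS; first by rewrite xE in xS.
    by case/andP: pth => /and3P[].
  have [/existsP[u /existsP[v /and3P[uS vS uv]]]|N] :=
    boolP [exists u, exists v, [&& u \in S, v \notin S & E u v]]; last first.
    suff BS : B \subset S by move: (subset_leq_card BS); rewrite cS leqNgt nB.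
    apply/subsetP => x; rewrite inE => /connectP[p pth ->] {x}.
    move: (r) rS pth => x; elim: p x => //= y p IHp x xS /andP[xy pth].
    apply: IHp pth.
    apply/negPn/negP => yS; case/negP: N; apply/existsP; exists x.
    by apply/existsP; exists y; rewrite xS yS.
  have uB : u \in B by apply: (subsetP SB).
  have vB : v \in B.
    by move: uB; rewrite !inE => /connect_trans; apply; apply: connect1.
  exists (v |: S) => [|x].
    by rewrite subUset sub1set vB SB cardsU1 vS cS eqxx.
  have sub : subrel (connect [rel u v | [&& E u v, u \in S & v \in S]])
      (connect [rel u v0 | [&& E u v0, u \in v |: S & v0 \in v |: S]]).
    apply: connect_sub => y z /= /and3P[yz yS zS]; apply: connect1 => /=.
    by rewrite yz !inE yS zS !orbT.
  case/setU1P=> [->|xS]; last by apply: sub; apply: HS.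
  apply: connect_trans (sub _ _ (HS u uS)) _; apply: connect1 => /=.
  by rewrite uv !inE uS eqxx orbT.
(* The set obtained for [n] has [n.+1] elements, so this one lacks exactly one. *)
have [|S /andP[SB /eqP cS] HS] := grow #|B|.-2.
  by move: B2; case: #|B| => [|[|m]] //= _; apply: ltnW.
have cB : #|B| = #|S|.+1 by rewrite cS; move: B2; case: #|B| => [|[|m]].
have /cards1P[b Hb] : #|B :\: S| == 1.
  by rewrite cardsD (setIidPr SB) cB subSnn.
have bB : b \in B :\: S by rewrite Hb set11.
move: bB; rewrite inE => /andP[bS bB].
exists b; first by rewrite inE in bB.
exists r => // x xB xb; have xS : x \in S.
  apply/negPn/negP => xS; have : x \in B :\: S by rewrite inE xS inE.
  by rewrite Hb inE (negbTE xb).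
apply: connect_sub (HS x xS) => y z /= /and3P[yz yS zS]; apply: connect1 => /=.
have := subsetP SB y yS; have := subsetP SB z zS; rewrite !inE => -> ->.
rewrite yz /=; apply/andP; split; [move: yS|move: zS]; apply: contraTneq => -> //.
Qed.

(** * Components of the graph of kept pairs *)

Section Merge.

Variable H : hypergraph.
Hypothesis uniH : uniform3 H.
Hypothesis covH : forall u v : vertex H, u != v -> exists e, u \in inc e /\ v \in inc e.

Implicit Types (e g h w : edge H) (a b c p q r t x y z : vertex H) (Z : {set vertex H}).
Implicit Types (f : edge H -> vertex H).

Definition adj f x y := (x != y) && [exists e, ends f e x && ends f e y].

Definition comp f r := [set x | connect (adj f) r x].

Lemma adj_sym f : symmetric (adj f).
Proof.
by move=> x y; rewrite /adj eq_sym; congr (_ && _); apply: eq_existsb => e; rewrite andbC.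
Qed.

Lemma link_sym f : connect_sym (adj f).
Proof. exact/sym_connect_sym/adj_sym. Qed.

Lemma joins_adj f e p q : joins f e p q -> adj f p q.
Proof.
move=> pq; rewrite /adj pq.1; apply/existsP; exists e.
by rewrite (joins_endl pq) (joins_endr pq).
Qed.

Lemma joins_link f e p q : joins f e p q -> connect (adj f) p q.
Proof. by move/joins_adj/connect1. Qed.

Lemma joins_comp f e r p q : joins f e p q -> (p \in comp f r) = (q \in comp f r).
Proof.
move=> pq; rewrite !inE; apply/idP/idP => /connect_trans; apply.
  exact: joins_link pq.
by rewrite link_sym; apply: joins_link pq.
Qed.

Lemma no_cut_closed f Z x y : omission f -> (forall e, cut f e Z = false) ->
  x \in Z -> connect (adj f) x y -> y \in Z.
Proof.
move=> om Hc xZ xy; rewrite -(closed_connect _ xy) // => u v.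
move=> /andP[uv /existsP[e /andP[ue ve]]].
by have := Hc e; rewrite (cutE _ (joinsI uniH om ue ve uv)); case: (u \in Z) => /= [/negbFE ->|->].
Qed.

Lemma rejoin f f' e p q t : omission f -> joins f e p t -> f e = q -> f' e = p ->
  joins f' e q t.
Proof.
move=> om pt fq fp; have /andP[pe pf] := joins_endl pt; have /andP[te tf] := joins_endr pt.
have qe := om e; rewrite fq in pf tf qe.
by apply: (joins_omit uniH qe te _ fp) => //; [rewrite eq_sym | case: pt].
Qed.

Lemma ends_neq f e e' x : ends f e x -> ~~ ends f e' x -> e != e'.
Proof. by move=> ex; apply: contraNneq => <-. Qed.

Lemma even_other_edge f e x : even_omission f -> ends f e x ->
  exists2 e', e' != e & ends f e' x.
Proof.
move=> [om /(_ x)]; rewrite /odd_deg (bigD1 e) //= => ev ex.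
case: (pickP (fun e' => (e' != e) && ends f e' x)) => [e' /andP[? ?]|N]; first by exists e'.
move: ev; rewrite ex big1 // => e' ne; have := N e'; by rewrite ne.
Qed.

(** Such an edge cannot damage the component: its omitted vertex is the same, or it had an end,
    hence both ends, outside. *)
Definition untouched f r f' e := (f' e == f e) || [exists p, ends f e p && (p \notin comp f r)].

Lemma cut_untouched f r f' x e : omission f -> untouched f r f' e ->
  cut f e (comp f r :&: comp f' x) = false.
Proof.
move=> om un; have [p [q pq]] := omission_joins uniH e om.
rewrite (cutE _ pq) 2!in_setI -(joins_comp r pq).
have [pB|pB] := boolP (p \in comp f r); rewrite //=.
case/orP: un => [/eqP fe|/existsP[t /andP[te tB]]].
  suff pq' : joins f' e p q by rewrite (joins_comp x pq') addbb.
  by case: pq => pq Hx; split=> // y; rewrite -Hx /ends fe.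
case: pq (joins_comp r pq) => _ Hx; rewrite pB => qB.
by move: te tB; rewrite Hx => /orP[] /eqP->; rewrite ?pB -?qB.
Qed.

(** The component is connected under [f], so a part of it that contains [x] and has no [f]-edge
    across its boundary is all of it. *)
Lemma comp_keep f r f' x : omission f -> x \in comp f r ->
  (forall e, cut f e (comp f r :&: comp f' x) = false) -> comp f r \subset comp f' x.
Proof.
move=> om xB Hc; apply/subsetP => y yB.
suff : y \in comp f r :&: comp f' x by rewrite inE => /andP[].
apply: no_cut_closed om Hc (_ : x \in _) _; first by rewrite !inE connect0 andbT -in_set.
move: xB yB; rewrite !inE => rx; apply: connect_trans; by rewrite link_sym.
Qed.

(** If the loss of [h] split the component, [h] would be a bridge of the even graph of [f]. *)
Lemma comp_keep1 f r f' x h : even_omission f -> x \in comp f r ->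
  (forall e, e != h -> untouched f r f' e) -> comp f r \subset comp f' x.
Proof.
move=> ev xB un; have om := ev.1.
have Hc e : e != h -> cut f e (comp f r :&: comp f' x) = false.
  by move/un; apply: cut_untouched.
apply: comp_keep => // e; have [->|] := eqVneq e h; last exact: Hc.
exact: cut_uniq.
Qed.

(** * Switches that enlarge a component *)

Definition growable f r : Prop :=
  exists f' r', even_omission f' /\ #|comp f r| < #|comp f' r'|.

Lemma growI f r f' x a : even_omission f' -> comp f r \subset comp f' x ->
  a \notin comp f r -> connect (adj f') x a -> growable f r.
Proof.
move=> ev sB aB xa; exists f', x; split=> //; apply/proper_card/properP; split=> //.
by exists a; rewrite // inE.
Qed.

(** The edge cannot keep both [a] and [b], since kept vertices share a component. So it omits one,
    and the third vertex lies on the side of the other. *)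
Lemma cross_edge f r e a b : omission f -> a \notin comp f r -> b \in comp f r ->
  a \in inc e -> b \in inc e ->
  (f e = a /\ exists2 t, t \in comp f r & joins f e b t) \/
  (f e = b /\ exists2 t, t \notin comp f r & joins f e a t).
Proof.
move=> om aB bB ae be; have [fa|fa] := eqVneq (f e) a.
  have : ends f e b by rewrite /ends be fa; apply: contraNneq aB => <-.
  case/(ends_joins uniH om)=> t bt; left; split=> //; exists t => //.
  by rewrite -(joins_comp r bt).
have ea : ends f e a by rewrite /ends ae eq_sym.
have [t at_] := ends_joins uniH om ea.
have tB : t \notin comp f r by rewrite -(joins_comp r at_).
right; split; last by exists t.
apply/eqP/negPn/negP => fb; have : ends f e b by rewrite /ends be eq_sym.
case: at_ => _ ->; case/orP => /eqP E; first by rewrite -E bB in aB.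
by rewrite -E bB in tB.
Qed.

Lemma cross_switchable f r e a b : omission f -> a \notin comp f r -> b \in comp f r ->
  a \in inc e -> b \in inc e -> switchable f (e, a, b).
Proof.
move=> om aB bB ae be; rewrite /switchable ae be /=; apply/andP; split.
  by apply: contraNneq aB => ->.
by have [[-> _]|[-> _]] := cross_edge om aB bB ae be; rewrite eqxx ?orbT.
Qed.

Lemma switchE a b : (switch a b a = b) * (switch a b b = a).
Proof. by rewrite /switch eqxx; split=> //; case: eqP. Qed.

Lemma notin_comp_neq f r a b : a \notin comp f r -> b \in comp f r -> a != b.
Proof. by move=> aB bB; apply: contraNneq aB => ->. Qed.

(** The switches follow the triangle [a1], [z], [b]. If [e1] or [e3] omitted [b], at most one edge
    of the component is lost and the bridge argument applies. Otherwise only edges at the non-cut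
    vertex [b] are lost: at worst [b] drops out, while [a1] and [a2] come in. *)
Lemma grow_triangle f r g a1 a2 z b r0 e1 e3 : even_omission f ->
  a1 \notin comp f r -> z \notin comp f r -> b \in comp f r -> r0 \in comp f r ->
  (forall x, x \in comp f r -> x != b ->
    connect [rel u v | [&& adj f u v, connect (adj f) r u, connect (adj f) r v, u != b & v != b]] r0 x) ->
  joins f g a1 a2 -> f g = z -> a1 \in inc e1 -> b \in inc e1 ->
  z \in inc e3 -> b \in inc e3 -> e1 != e3 -> growable f r.
Proof.
move=> ev aB zB bB r0B ncut ja fg ae1 be1 ze3 be3 e13; have om := ev.1.
have a2B : a2 \notin comp f r by rewrite -(joins_comp r ja).
have /andP[a1g a1z] := joins_endl ja; have /andP[a2g a2z] := joins_endr ja.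
have zg := om g; rewrite fg in a1z a2z zg.
have a1b := notin_comp_neq aB bB; have zb := notin_comp_neq zB bB.
have bg : b \notin inc g.
  rewrite (three_vertices uniH b a1g a2g zg ja.1 a1z a2z) !negb_or.
  by rewrite !(eq_sym b) a1b zb (notin_comp_neq a2B bB).
have ge1 : g != e1 by apply: contraNneq bg => ->.
have ge3 : g != e3 by apply: contraNneq bg => ->.
set s := [:: (g, a1, z); (e1, a1, b); (e3, z, b)].
set f' := switches f s.
have f'g : f' g = a1 by rewrite /f' /= eqxx fg switchE.
have f'1 : f' e1 = switch a1 b (f e1) by rewrite /f' /= eq_sym (negbTE ge1) eqxx.
have f'3 : f' e3 = switch z b (f e3).
  by rewrite /f' /= eq_sym (negbTE ge3) eq_sym (negbTE e13) eqxx.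
have f'o e : e != g -> e != e1 -> e != e3 -> f' e = f e.
  by rewrite /f' /= => /negbTE-> /negbTE-> /negbTE->.
have ev' : even_omission f'.
  apply: switches_even => //.
  - by rewrite /= !inE negb_or ge1 ge3 e13.
  - apply/and3P; split; last by rewrite andbT; apply: (cross_switchable om zB).
      by rewrite /= a1g zg a1z fg eqxx orbT.
    exact: (cross_switchable om aB).
  - move=> x; rewrite !big_cons big_nil /=.
    by case: (x == a1); case: (x == z); case: (x == b).
have un_g : untouched f r f' g.
  by apply/orP; right; apply/existsP; exists a1; rewrite (joins_endl ja).
have un e : e != e1 -> e != e3 -> untouched f r f' e.
  move=> n1 n3; have [->//|ng] := eqVneq e g.
  by rewrite /untouched f'o ?eqxx.
have [[fe1 [b1 b1B j1]]|[fe1 [t tB j1]]] := cross_edge om aB bB ae1 be1; last first.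
  have jn : joins f' e1 b t by apply: (rejoin om j1 fe1); rewrite f'1 fe1 switchE.
  apply: (growI ev' _ tB (joins_link jn)); apply: (comp_keep1 ev bB (h := e3)) => e n3.
  have [->|n1] := eqVneq e e1; last exact: un.
  by apply/orP; right; apply/existsP; exists a1; rewrite (joins_endl j1).
have [[fe3 [b3 b3B j3]]|[fe3 [t tB j3]]] := cross_edge om zB bB ze3 be3; last first.
  have jn : joins f' e3 b t by apply: (rejoin om j3 fe3); rewrite f'3 fe3 switchE.
  apply: (growI ev' _ tB (joins_link jn)); apply: (comp_keep1 ev bB (h := e1)) => e n1.
  have [->|n3] := eqVneq e e3; last exact: un.
  by apply/orP; right; apply/existsP; exists z; rewrite (joins_endl j3).
have jn1 : joins f' e1 a1 b1 by apply: (rejoin om j1 fe1); rewrite f'1 fe1 switchE.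
have jn3 : joins f' e3 z b3 by apply: (rejoin om j3 fe3); rewrite f'3 fe3 switchE.
have jng : joins f' g z a2 by apply: (rejoin om ja fg); rewrite f'g.
(* Edges of the component that avoid [b] are none of the three switched ones. *)
have keep x : x \in comp f r -> x != b -> connect (adj f') r0 x.
  move=> xB xb; apply: connect_sub (ncut x xB xb) => u v /=.
  move=> /and5P[/andP[uv /existsP[e /andP[ue ve]]] uB vB ub vb].
  have only e' t : joins f e' b t -> e != e'.
    case=> _ He'; apply/eqP => E; move: ue ve; rewrite E !He'.
    rewrite (negbTE ub) (negbTE vb) /= => /eqP uE /eqP vE.
    by move: uv; rewrite uE vE eqxx.
  have ne1 : e != e1 by apply: only j1.
  have ne3 : e != e3 by apply: only j3.
  have neg : e != g.
    apply/eqP => E; move: ue; rewrite E; case: ja => _ ->.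
    by case/orP => /eqP uE; [move: aB | move: a2B]; rewrite -uE inE uB.
  apply: connect1; rewrite /adj uv; apply/existsP; exists e.
  by move: ue ve; rewrite /ends f'o // => -> ->.
have b1b : b1 != b by rewrite eq_sym; case: j1.
have b3b : b3 != b by rewrite eq_sym; case: j3.
have l1 : connect (adj f') r0 a1.
  by apply: connect_trans (keep _ b1B b1b) _; rewrite link_sym; apply: joins_link jn1.
have l2 : connect (adj f') r0 a2.
  apply: connect_trans (keep _ b3B b3b) _; apply: connect_trans (joins_link jng).
  by rewrite link_sym; apply: joins_link jn3.
exists f', r0; split=> //.
have sub : a1 |: (a2 |: (comp f r :\ b)) \subset comp f' r0.
  rewrite !subUset !sub1set ![_ \in comp f' _]inE l1 l2 /=.
  by apply/subsetP => x; rewrite in_setD1 => /andP[xb xB]; rewrite inE keep.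
apply: leq_trans (subset_leq_card sub).
rewrite !cardsU1 !in_setU1 !in_setD1 (negbTE aB) (negbTE a2B) !andbF !orbF ja.1 /=.
by rewrite (cardsD1 b (comp f r)) bB.
Qed.

Lemma grow_outside f r g a : even_omission f -> 1 < #|comp f r| ->
  ends f g a -> a \notin comp f r -> f g \notin comp f r -> growable f r.
Proof.
move=> ev B2 ga aB zB; have om := ev.1.
have [b bB [r0 r0B ncut]] := noncut_vertex B2.
have [a2 ja] := ends_joins uniH om ga.
have a2B : a2 \notin comp f r by rewrite -(joins_comp r ja).
have bB' : b \in comp f r by rewrite inE.
have r0B' : r0 \in comp f r by rewrite inE.
have ncut' x : x \in comp f r -> x != b -> connect [rel u v |
    [&& adj f u v, connect (adj f) r u, connect (adj f) r v, u != b & v != b]] r0 x.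
  by rewrite inE; apply: ncut.
have [e1 [ae1 be1]] := covH (notin_comp_neq aB bB').
have [e3 [ze3 be3]] := covH (notin_comp_neq zB bB').
have [E|e13] := eqVneq e1 e3; last first.
  exact: (@grow_triangle f r g a a2 (f g) b r0 e1 e3).
(* If one edge covers both pairs, it consists of [a], [b] and [f g]; exchanging the roles of [a] and
   [a2] gives distinct edges. *)
have [e2 [ae2 be2]] := covH (notin_comp_neq a2B bB').
apply: (@grow_triangle f r g a2 a (f g) b r0 e2 e3) => //.
  exact: joins_sym.
have /andP[_ az] := joins_endl ja; have /andP[_ a2z] := joins_endr ja.
apply: contraTneq ae2 => ->.
rewrite E in ae1; rewrite (three_vertices uniH _ ae1 be3 ze3) //.
- by rewrite !negb_or a2z (notin_comp_neq a2B bB') eq_sym ja.1.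
- exact: notin_comp_neq aB bB'.
- by rewrite eq_sym (notin_comp_neq zB bB').
Qed.

(** Both edges are switched along the 2-cycle [a], [b]. Then [e1] links [b] to the outside, and only
    [e2] can be lost. *)
Lemma grow_double f r e1 e2 a b : even_omission f -> a \notin comp f r -> b \in comp f r ->
  e1 != e2 -> a \in inc e1 -> f e1 = b -> a \in inc e2 -> b \in inc e2 -> growable f r.
Proof.
move=> ev aB bB e12 ae1 fe1 ae2 be2; have om := ev.1.
have be1 : b \in inc e1 by rewrite -fe1.
have := cross_edge om aB bB ae1 be1; rewrite fe1 => -[[E]|[_ [t tB j1]]].
  by rewrite -E bB in aB.
set s := [:: (e1, a, b); (e2, a, b)]; set f' := switches f s.
have ev' : even_omission f'.
  apply: switches_even => //=; first by rewrite inE e12.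
    apply/and3P; split=> //; exact: (@cross_switchable f r).
  move=> x; rewrite !big_cons big_nil /=.
  by case: (x == a); case: (x == b).
have jn : joins f' e1 b t by apply: (rejoin om j1 fe1); rewrite /f' /= eqxx fe1 switchE.
apply: (growI ev' _ tB (joins_link jn)); apply: (comp_keep1 ev bB (h := e2)) => e n2.
apply/orP; have [->|n1] := eqVneq e e1; last by left; rewrite /f' /= (negbTE n1) (negbTE n2).
by right; apply/existsP; exists a; rewrite (joins_endl j1).
Qed.

(* The two ways of routing the switch through [h] change the same two edges
   [h] and [w] inside the component. If both of them disconnect it, the
   intersection of the two pieces containing [b3] is crossed by [h] alone. *)
Lemma grow_either f r f1 f2 h w b2 b3 z z' t1 t2 : even_omission f ->
  even_omission f1 -> even_omission f2 -> h != w ->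
  b2 \in comp f r -> b3 \in comp f r -> z \in comp f r ->
  joins f h b2 b3 -> joins f w z z' -> joins f1 h z b2 -> joins f2 h z b3 ->
  (forall e, e != h -> e != w -> untouched f r f1 e) ->
  (forall e, e != h -> e != w -> untouched f r f2 e) ->
  t1 \notin comp f r -> connect (adj f1) b3 t1 ->
  t2 \notin comp f r -> connect (adj f2) b2 t2 -> growable f r.
Proof.
move=> ev ev1 ev2 hw b2B b3B zB jh jw jh1 jh2 un1 un2 t1B l1 t2B l2; have om := ev.1.
set Z1 := comp f r :&: comp f1 b3; set Z2 := comp f r :&: comp f2 b3.
have c1 e : e != h -> e != w -> cut f e Z1 = false.
  by move=> nh nw; apply: cut_untouched => //; apply: un1.
have c2 e : e != h -> e != w -> cut f e Z2 = false.
  by move=> nh nw; apply: cut_untouched => //; apply: un2.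
have b3Z1 : b3 \in Z1 by rewrite in_setI b3B inE connect0.
have b3Z2 : b3 \in Z2 by rewrite in_setI b3B inE connect0.
have hw1 := cut_pair ev hw c1; have hw2 := cut_pair ev hw c2.
have [b2Z1|b2Z1] := boolP (b2 \in Z1).
  apply: (growI ev1 _ t1B l1); apply: comp_keep => // e.
  have h0 : cut f h Z1 = false by rewrite (cutE _ jh) b2Z1 b3Z1.
  have [->//|nh] := eqVneq e h; have [->|nw] := eqVneq e w; last exact: c1.
  by rewrite -/Z1 -hw1.
have [b2Z2|b2Z2] := boolP (b2 \in Z2).
  have b2l : connect (adj f2) b3 b2 by move: b2Z2; rewrite !inE => /andP[].
  apply: (growI ev2 _ t2B (connect_trans b2l l2)); apply: comp_keep => // e.
  have h0 : cut f h Z2 = false by rewrite (cutE _ jh) b2Z2 b3Z2.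
  have [->//|nh] := eqVneq e h; have [->|nw] := eqVneq e w; last exact: c2.
  by rewrite -/Z2 -hw2.
have zZ1 : z \notin Z1.
  by move: b2Z1; rewrite !in_setI b2B zB /= (joins_comp _ jh1).
have zZ2 : z \in Z2.
  by rewrite in_setI zB /= (joins_comp _ jh2) inE connect0.
have z'Z2 : z' \notin Z2.
  move: hw2; rewrite (cutE _ jh) (cutE _ jw) b3Z2 zZ2 (negbTE b2Z2) /=.
  by case: (z' \in Z2).
have : cut f h (Z1 :&: Z2) = cut f w (Z1 :&: Z2).
  apply: (cut_pair ev hw) => e nh nw; have [p [q pq]] := omission_joins uniH e om.
  move: (c1 e nh nw) (c2 e nh nw); rewrite !(cutE _ pq) !in_setI.
  by do 4!case: (_ \in _).
rewrite (cutE _ jh) (cutE _ jw) ![_ \in Z1 :&: Z2]in_setI b3Z1 b3Z2.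
by rewrite (negbTE b2Z1) (negbTE zZ1) (negbTE z'Z2) andbF.
Qed.

(** Unless two edges share a crossing pair as in [grow_double], the switches follow the 4-cycle [a],
    [b3], [z], [c]. The component may lose both [h] and [g], but their ends stay linked through the
    outside, where by hypothesis any two vertices are joined. *)
Lemma grow_square f r (x3 x2 : edge H) h a a2 a3 b2 b3 z : even_omission f ->
  (forall p q, p \notin comp f r -> q \notin comp f r -> p != q ->
     exists2 e, joins f e p q & f e \in comp f r) ->
  a \notin comp f r -> x3 != x2 ->
  joins f x3 a a2 -> f x3 = b3 -> joins f x2 a a3 -> f x2 = b2 ->
  joins f h b2 b3 -> f h = z -> b2 \in comp f r -> b3 \in comp f r ->
  z \notin comp f r -> growable f r.
Proof.
move=> ev full aB x32 j3 fx3 j2 fx2 jh fh b2B b3B zB; have om := ev.1.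
have a2B : a2 \notin comp f r by rewrite -(joins_comp r j3).
have a3B : a3 \notin comp f r by rewrite -(joins_comp r j2).
have /andP[ax3 ab3] := joins_endl j3; have /andP[a2x3 a2b3] := joins_endr j3.
have /andP[ax2 ab2] := joins_endl j2; have /andP[a3x2 a3b2] := joins_endr j2.
have /andP[b2h b2z] := joins_endl jh; have /andP[b3h b3z] := joins_endr jh.
have b3x3 : b3 \in inc x3 by rewrite -fx3.
have zh : z \in inc h by rewrite -fh.
have hx3 : x3 != h by apply: contraNneq zB => E; rewrite -fh -E fx3.
have hx2 : x2 != h by apply: contraNneq zB => E; rewrite -fh -E fx2.
have [E|za] := eqVneq z a.
  by apply: (@grow_double f r x3 h a b3) => //; rewrite -E.
have [E|za2] := eqVneq z a2.
  by apply: (@grow_double f r x3 h a2 b3) => //; rewrite -E.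
have [E|za3] := eqVneq z a3.
  by apply: (@grow_double f r x2 h a3 b2) => //; rewrite -E.
have [q jq] := full _ _ zB a2B za2; set c := f q => cB.
have /andP[zq zc] := joins_endl jq; have /andP[a2q a2c] := joins_endr jq.
have cq : c \in inc q by apply: om.
have x3q : x3 != q by apply: (ends_neq (joins_endl j3)); rewrite jq.2 negb_or eq_sym za j3.1.
have [cb3|cb3] := eqVneq c b3.
  by apply: (@grow_double f r x3 q a2 b3) => //; rewrite -cb3.
have ac := notin_comp_neq aB cB.
have [g [ag cg]] := covH ac.
have aNq : a \notin inc q.
  rewrite (three_vertices uniH _ zq a2q cq) // ?jq.1 // !negb_or ac.
  by rewrite eq_sym za j3.1.
have aNh : a \notin inc h.
  rewrite (three_vertices uniH _ b2h b3h zh jh.1) -?fh // !negb_or fh.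
  by rewrite (notin_comp_neq aB b2B) (notin_comp_neq aB b3B) eq_sym za.
have cNx3 : c \notin inc x3.
  rewrite (three_vertices uniH _ ax3 a2x3 b3x3 j3.1) -?fx3 // !negb_or fx3 cb3 andbT.
  by rewrite !(eq_sym c) ac (notin_comp_neq a2B cB).
have x3g : x3 != g by apply: contraNneq cNx3 => ->.
have hq : h != q by apply: contraNneq zB => E; rewrite -fh E.
have hg : h != g by apply: contraNneq aNh => ->.
have qg : q != g by apply: contraNneq aNq => ->.
set s := [:: (x3, a, b3); (h, z, b3); (q, z, c); (g, a, c)].
set f' := switches f s.
have f'3 : f' x3 = a by rewrite /f' /= eqxx fx3 switchE.
have f'h : f' h = b3 by rewrite /f' /= eq_sym (negbTE hx3) eqxx fh switchE.
have f'q : f' q = z.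
  by rewrite /f' /= eq_sym (negbTE x3q) eq_sym (negbTE hq) eqxx switchE.
have f'g : f' g = switch a c (f g).
  by rewrite /f' /= eq_sym (negbTE x3g) eq_sym (negbTE hg) eq_sym (negbTE qg) eqxx.
have f'o e : e != x3 -> e != h -> e != q -> e != g -> f' e = f e.
  by rewrite /f' /= => /negbTE-> /negbTE-> /negbTE-> /negbTE->.
have ev' : even_omission f'.
  apply: switches_even => //.
  - by rewrite /= !inE !negb_or hx3 x3q x3g hq hg qg.
  - rewrite /= -!/(switchable f (_, _, _)) !(@cross_switchable f r) //.
  - move=> x; rewrite !big_cons big_nil /=.
    by case: (x == a); case: (x == b3); case: (x == z); case: (x == c).
have jn3 : joins f' x3 b3 a2 by apply: (rejoin om j3).
have jnh : joins f' h z b2 by apply: (rejoin om (joins_sym jh)).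
have jnq : joins f' q c a2 by apply: (rejoin om jq).
have un e : e != h -> e != g -> untouched f r f' e.
  move=> nh ng; have [->|n3] := eqVneq e x3.
    by apply/orP; right; apply/existsP; exists a; rewrite (joins_endl j3).
  have [->|nq] := eqVneq e q; last by rewrite /untouched f'o ?eqxx.
  by apply/orP; right; apply/existsP; exists z; rewrite (joins_endl jq).
(* If [g] omitted [c], only [h] is lost; otherwise both [h] and [g] are. *)
have l3 := joins_link jn3.
have [[fg [c' c'B jg]]|[fg [t tB jg]]] := cross_edge om aB cB ag cg; last first.
  apply: (growI ev' _ a2B l3); apply: (comp_keep1 ev b3B (h := h)) => e nh.
  have [->|ng] := eqVneq e g; last exact: un.
  by apply/orP; right; apply/existsP; exists a; rewrite (joins_endl jg).
have jng : joins f' g a c' by apply: (rejoin om jg fg); rewrite f'g fg switchE.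
have kept e p1 p2 : joins f e p1 p2 -> e != x3 -> e != h -> e != q -> e != g ->
    connect (adj f') p1 p2.
  move=> je n3 nh nq ng; apply: (@joins_link f' e).
  by case: je => ? Hx; split=> // y; rewrite -Hx /ends f'o.
have eNh e y : y \notin comp f r -> ends f e y -> e != h.
  move=> yB ey; apply: (ends_neq ey); rewrite jh.2 negb_or.
  by rewrite (notin_comp_neq yB b2B) (notin_comp_neq yB b3B).
have eNg e y : y \notin comp f r -> ends f e y -> e != g.
  move=> yB ey; apply: (ends_neq ey); rewrite jg.2 negb_or.
  by rewrite (notin_comp_neq yB cB) (notin_comp_neq yB c'B).
have aNa2 := j3.1.
have laz : connect (adj f') a z.
  have [|e je _] := full a z aB zB; first by rewrite eq_sym.
  apply: (kept e _ _ je _ (eNh _ _ aB (joins_endl je)) _ (eNg _ _ aB (joins_endl je))).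
    by apply: (ends_neq (joins_endr je)); rewrite j3.2 negb_or za.
  by apply: (ends_neq (joins_endl je)); rewrite jq.2 negb_or aNa2 eq_sym za.
have la3 : connect (adj f') a a3.
  apply: (kept x2 _ _ j2 _ hx2 _ (eNg _ _ aB (joins_endl j2))); first by rewrite eq_sym.
  by apply: (ends_neq (joins_endl j2)); rewrite jq.2 negb_or aNa2 eq_sym za.
have la2 : connect (adj f') a2 a.
  rewrite link_sym; have [E|a23] := eqVneq a2 a3; first by rewrite E.
  apply: connect_trans la3 _; have [|e je _] := full a3 a2 a3B a2B; first by rewrite eq_sym.
  apply: (kept e _ _ je _ (eNh _ _ a3B (joins_endl je)) _ (eNg _ _ a3B (joins_endl je))).
    apply: (ends_neq (joins_endl je)); rewrite j3.2 negb_or.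
    by rewrite !(eq_sym a3) a23 j2.1.
  apply: (ends_neq (joins_endl je)); rewrite jq.2 negb_or.
  by rewrite !(eq_sym a3) a23 za3.
have l3a : connect (adj f') b3 a by apply: connect_trans l3 la2.
have lb2 : connect (adj f') b3 b2.
  exact: connect_trans l3a (connect_trans laz (joins_link jnh)).
have lc : connect (adj f') b3 c.
  by apply: connect_trans l3 _; rewrite link_sym; apply: joins_link jnq.
have lc' : connect (adj f') b3 c' by apply: connect_trans l3a (joins_link jng).
apply: (growI ev' _ a2B l3); apply: comp_keep => // e.
have [->|nh] := eqVneq e h.
  by rewrite (cutE _ jh) !in_setI b2B b3B ![_ \in comp f' _]inE lb2 connect0.
have [->|ng] := eqVneq e g.
  by rewrite (cutE _ jg) !in_setI cB c'B ![_ \in comp f' _]inE lc lc'.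
by apply: cut_untouched => //; apply: un.
Qed.

(** Evenness gives two edges [x3], [x2] at [a], omitting [b3], [b2] in the component. The cases
    depend on the vertex omitted by an edge [h] covering [b2] and [b3]. *)
Lemma grow_inside f r e a : even_omission f -> a \notin comp f r -> ends f e a ->
  (forall g p, ends f g p -> p \notin comp f r -> f g \in comp f r) -> growable f r.
Proof.
move=> ev aB ea out; have om := ev.1.
have full p q : p \notin comp f r -> q \notin comp f r -> p != q ->
    exists2 g, joins f g p q & f g \in comp f r.
  move=> pB qB pq; have [g [pg qg]] := covH pq.
  have fgB : f g \in comp f r.
    have [E|fp] := eqVneq (f g) p.
      by apply: (out g q); rewrite // /ends qg E eq_sym.
    by apply: (out g p); rewrite // /ends pg eq_sym.
  exists g => //; apply: joinsI => //; rewrite /ends ?pg ?qg /=;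
    exact: notin_comp_neq fgB.
have [x2 x2e ax2] := even_other_edge ev ea; move: ea x2e.
move: e => x3 ax3 x23; rewrite eq_sym in x23.
have [a2 j3] := ends_joins uniH om ax3; have [a3 j2] := ends_joins uniH om ax2.
have b3B : f x3 \in comp f r by apply: (out _ a).
have b2B : f x2 \in comp f r by apply: (out _ a).
set b3 := f x3 in b3B; set b2 := f x2 in b2B.
have a2B : a2 \notin comp f r by rewrite -(joins_comp r j3).
have a3B : a3 \notin comp f r by rewrite -(joins_comp r j2).
have /andP[aix3 ab3] := ax3; have /andP[aix2 ab2] := ax2.
have b3x3 : b3 \in inc x3 := om x3; have b2x2 : b2 \in inc x2 := om x2.
have [E|b23] := eqVneq b2 b3.
  by apply: (@grow_double f r x3 x2 a b3) => //; rewrite -E.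
have [h [b2h b3h]] := covH b23.
have b2Nx3 : b2 \notin inc x3.
  have /andP[a2x3 a2b3] := joins_endr j3.
  rewrite (three_vertices uniH _ aix3 a2x3 b3x3 j3.1) // !negb_or b23 andbT.
  by rewrite !(eq_sym b2) (notin_comp_neq aB b2B) (notin_comp_neq a2B b2B).
have b3Nx2 : b3 \notin inc x2.
  have /andP[a3x2 a3b2] := joins_endr j2.
  rewrite (three_vertices uniH _ aix2 a3x2 b2x2 j2.1) // !negb_or eq_sym.
  by rewrite (notin_comp_neq aB b3B) eq_sym (notin_comp_neq a3B b3B) eq_sym b23.
have x3h : x3 != h by apply: contraNneq b2Nx3 => ->.
have x2h : x2 != h by apply: contraNneq b3Nx2 => ->.
have un3 f' : untouched f r f' x3.
  by apply/orP; right; apply/existsP; exists a; rewrite ax3.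
have un2 f' : untouched f r f' x2.
  by apply/orP; right; apply/existsP; exists a; rewrite ax2.
(* The triangle [a], [b3], [b2] can be switched, and the component loses at most [h]. *)
have [fh|fh] := boolP ((f h == b2) || (f h == b3)).
  set s := [:: (x3, a, b3); (x2, a, b2); (h, b2, b3)]; set f' := switches f s.
  have ev' : even_omission f'.
    apply: switches_even => //.
    - by rewrite /= !inE negb_or x23 x3h x2h.
    - apply/and3P; split; try exact: (@cross_switchable f r).
      by rewrite /= b2h b3h b23 fh.
    - move=> x; rewrite !big_cons big_nil /=.
      by case: (x == a); case: (x == b2); case: (x == b3).
  have jn : joins f' x3 b3 a2.
    by apply: (rejoin om j3) => //; rewrite /f' /= eqxx -/b3 switchE.
  apply: (growI ev' _ a2B (joins_link jn)); apply: (comp_keep1 ev b3B (h := h)) => e nh.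
  have [->|n3] := eqVneq e x3; first exact: un3.
  have [->|n2] := eqVneq e x2; first exact: un2.
  by apply/orP; left; rewrite /f' /= (negbTE n3) (negbTE n2) (negbTE nh).
move: fh; rewrite negb_or => /andP[fb2 fb3].
have jh : joins f h b2 b3 by apply: joinsI; rewrite // /ends ?b2h ?b3h eq_sym.
set z := f h; have zh : z \in inc h := om h.
have [zB|zB] := boolP (z \in comp f r); last first.
  exact: (@grow_square f r x3 x2 h a a2 a3 b2 b3 z).
have az := notin_comp_neq aB zB; have [w [aw zw]] := covH az.
have aNh : a \notin inc h.
  have b2z : b2 != z by rewrite eq_sym.
  have b3z : b3 != z by rewrite eq_sym.
  rewrite (three_vertices uniH _ b2h b3h zh b23 b2z b3z) !negb_or az.
  by rewrite (notin_comp_neq aB b2B) (notin_comp_neq aB b3B).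
have hw : h != w by apply: contraNneq aNh => ->.
have zNx (x : edge H) y b : ends f x a -> f x = b -> joins f x a y -> b \in comp f r -> z != b ->
    x != w.
  move=> xa fx jx bB zb; have /andP[yx yb] := joins_endr jx; have /andP[ax ab] := xa.
  have bx := om x; have yB : y \notin comp f r by rewrite -(joins_comp r jx).
  have : z \notin inc x; last by apply: contraNneq => ->.
  rewrite (three_vertices uniH _ ax yx bx jx.1) // !negb_or fx zb andbT.
  by rewrite !(eq_sym z) az (notin_comp_neq yB zB).
have x3w : x3 != w by apply: (zNx x3 a2 b3).
have x2w : x2 != w by apply: (zNx x2 a3 b2).
(* With [z] in the component there are two triangles through [a] and [z], one over [b3] and one over
   [b2]; both use [h] and [w]. *)
pose s1 := [:: (x3, a, b3); (h, z, b3); (w, a, z)]; set f1 := switches f s1.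
have ev1 : even_omission f1.
  apply: switches_even => //.
  - by rewrite /= !inE negb_or x3h x3w hw.
  - apply/and3P; split; try exact: (@cross_switchable f r).
      by rewrite /= zh b3h fb3 eqxx.
    by rewrite andbT; apply: (@cross_switchable f r).
  - move=> x; rewrite !big_cons big_nil /=.
    by case: (x == a); case: (x == z); case: (x == b3).
pose s2 := [:: (x2, a, b2); (h, z, b2); (w, a, z)]; set f2 := switches f s2.
have ev2 : even_omission f2.
  apply: switches_even => //.
  - by rewrite /= !inE negb_or x2h x2w hw.
  - apply/and3P; split; try exact: (@cross_switchable f r).
      by rewrite /= zh b2h fb2 eqxx.
    by rewrite andbT; apply: (@cross_switchable f r).
  - move=> x; rewrite !big_cons big_nil /=.
    by case: (x == a); case: (x == z); case: (x == b2).
have jn1 : joins f1 x3 b3 a2.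
  by apply: (rejoin om j3) => //; rewrite /f1 /= eqxx -/b3 switchE.
have jn2 : joins f2 x2 b2 a3.
  by apply: (rejoin om j2) => //; rewrite /f2 /= eqxx -/b2 switchE.
have un1 e : e != h -> e != w -> untouched f r f1 e.
  move=> nh nw; have [->|n3] := eqVneq e x3; first exact: un3.
  by apply/orP; left; rewrite /f1 /= (negbTE n3) (negbTE nw) (negbTE nh).
have un2' e : e != h -> e != w -> untouched f r f2 e.
  move=> nh nw; have [->|n2] := eqVneq e x2; first exact: un2.
  by apply/orP; left; rewrite /f2 /= (negbTE n2) (negbTE nw) (negbTE nh).
have [[fw [z' z'B jw]]|[fw [t tB jw]]] := cross_edge om aB zB aw zw; last first.
  apply: (growI ev1 _ a2B (joins_link jn1)); apply: (comp_keep1 ev b3B (h := h)) => e nh.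
  have [->|nw] := eqVneq e w; last exact: un1.
  by apply/orP; right; apply/existsP; exists a; rewrite (joins_endl jw).
apply: (@grow_either f r f1 f2 h w b2 b3 z z' a2 a3) => //.
- by apply: (rejoin om (joins_sym jh)) => //; rewrite /f1 /= eq_sym (negbTE x3h) eqxx switchE.
- by apply: (rejoin om jh) => //; rewrite /f2 /= eq_sym (negbTE x2h) eqxx switchE.
- exact: joins_link jn1.
- exact: joins_link jn2.
Qed.

Lemma grow_component f r e a : even_omission f -> 1 < #|comp f r| ->
  ends f e a -> a \notin comp f r -> growable f r.
Proof.
move=> ev B2 ea aB.
have [/existsP[g /existsP[p /and3P[gp pB fB]]]|N] := boolP [exists g, exists p,
    [&& ends f g p, p \notin comp f r & f g \notin comp f r]].
  exact: grow_outside gp pB fB.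
apply: (grow_inside ev aB ea) => g p gp pB; apply/negPn/negP => fB.
by case/negP: N; apply/existsP; exists g; apply/existsP; exists p; apply/and3P.
Qed.

Lemma connected_even_omission : 0 < #|edge H| -> (exists f, even_omission f) ->
  exists f r, even_omission f /\ forall e x, ends f e x -> x \in comp f r.
Proof.
move=> /card_gt0P[e0 _] [f0 ev0].
have start : exists f r, even_omission f /\ 1 < #|comp f r|.
  have [p [q pq]] := omission_joins uniH e0 ev0.1; exists f0, p; split=> //.
  rewrite (cardsD1 p) inE connect0 (cardsD1 q) !inE eq_sym pq.1.
  by rewrite (joins_link pq).
(* Here [n] bounds the number of enlargements, as a component has at most as many vertices as
   [H]. *)
suff grow n f r : even_omission f -> 1 < #|comp f r| -> #|vertex H| < #|comp f r| + n ->
    exists f r, even_omission f /\ forall e x, ends f e x -> x \in comp f r.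
  have [f [r [ev B2]]] := start; apply: (grow #|vertex H| f r) => //.
  by rewrite -[X in X < _]add0n ltn_add2r ltnW.
elim: n f r => [|n IHn] f r ev B2 le.
  by move: le; rewrite addn0 ltnNge max_card.
have [/existsP[e /existsP[a /andP[ea aB]]]|N] := boolP [exists e, exists a,
    ends f e a && (a \notin comp f r)].
  have [f' [r' [ev' lt]]] := grow_component ev B2 ea aB.
  apply: (IHn f' r' ev' (ltn_trans B2 lt)).
  by apply: leq_trans le _; rewrite addnS -addSn leq_add2r.
exists f, r; split=> // e x ex; apply/negPn/negP => xB; case/negP: N.
by apply/existsP; exists e; apply/existsP; exists x; rewrite ex.
Qed.

End Merge.

(** * Euler tours *)

Section Euler.

Variable H : hypergraph.
Hypothesis uniH : uniform3 H.

Implicit Types (e : edge H) (p q u v w x : vertex H).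
Implicit Types (f : edge H -> vertex H) (s : seq (edge H * vertex H)).

(** A walk that passes each edge through the two vertices kept by [f], that is, a walk in an
    ordinary multigraph. *)
Fixpoint route f v s :=
  if s is (e, w) :: s' then [&& ends f e v, ends f e w, v != w & route f w s'] else true.

Lemma route_walk f v s : route f v s -> walk v s.
Proof.
elim: s v => [|[e w] s IHs] v //= /and4P[/andP[-> _] /andP[-> _] -> /IHs ->].
by [].
Qed.

Lemma route_cat f v s1 s2 :
  route f v (s1 ++ s2) = route f v s1 && route f (last v (unzip2 s1)) s2.
Proof. by elim: s1 v => [|[e w] s1 IHs] v //=; rewrite IHs !andbA. Qed.

Lemma route_parity f v s x : omission f -> route f v s ->
  \big[addb/false]_(e <- unzip1 s) ends f e x = (x == v) (+) (x == last v (unzip2 s)).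
Proof.
move=> om; elim: s v => [|[e w] s IHs] v /=; first by rewrite big_nil addbb.
move=> /and4P[ve we vw rs]; rewrite big_cons (IHs w rs) addbA; congr (_ (+) _).
have [_ ->] := joinsI uniH om ve we vw.
by case: (eqVneq x v) => [->|]; rewrite ?(negbTE vw) //= addbb.
Qed.

Lemma route_end f v s : even_omission f -> route f v s -> uniq (unzip1 s) ->
  last v (unzip2 s) = v \/
  exists2 e, e \notin unzip1 s & ends f e (last v (unzip2 s)).
Proof.
move=> [om ev] rs us; set x := last _ _.
case: (pickP (fun e => (e \notin unzip1 s) && ends f e x)) => [e /andP[? ?]|N].
  by right; exists e.
left; apply/eqP; have := route_parity x om rs; rewrite eqxx addbT big_uniq //.
have := ev x; rewrite /odd_deg (bigID (mem (unzip1 s))) /= [X in _ (+) X]big1 ?addbF.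
  by move=> -> /esym/negbFE.
by move=> e es; have := N e; rewrite es.
Qed.

Lemma route_ends f v s e x : omission f -> route f v s -> e \in unzip1 s ->
  ends f e x -> x \in v :: unzip2 s.
Proof.
move=> om; elim: s v => [|[e1 w] s IHs] v //= /and4P[ve we vw rs].
rewrite inE => /orP[/eqP->|es ex].
  have [_ ->] := joinsI uniH om ve we vw.
  by case/orP => /eqP->; rewrite !inE eqxx ?orbT.
by rewrite inE (IHs w) ?orbT.
Qed.

Lemma route_split v s p : p \in v :: unzip2 s ->
  exists s1 s2, s = s1 ++ s2 /\ last v (unzip2 s1) = p.
Proof.
elim: s v => [|[e w] s IHs] v; first by rewrite inE => /eqP->; exists [::], [::].
rewrite inE => /orP[/eqP->|]; first by exists [::], ((e, w) :: s).
by case/IHs=> s1 [s2 [-> <-]]; exists ((e, w) :: s1), s2.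
Qed.

Lemma route_extend f v s e : omission f -> route f v s -> uniq (unzip1 s) ->
  e \notin unzip1 s -> ends f e (last v (unzip2 s)) ->
  exists v' s', [/\ route f v' s', uniq (unzip1 s') & size s' = (size s).+1].
Proof.
move=> om rs us es /(ends_joins uniH om)[w jw]; exists v, (rcons s (e, w)); split.
- by rewrite -cats1 route_cat rs /= (joins_endl jw) (joins_endr jw) jw.1.
- by rewrite /unzip1 map_rcons rcons_uniq es.
- by rewrite size_rcons.
Qed.

Lemma route_grow f r v s e0 : even_omission f ->
  (forall e x, ends f e x -> x \in comp f r) ->
  route f v s -> uniq (unzip1 s) -> e0 \notin unzip1 s ->
  exists v' s', [/\ route f v' s', uniq (unzip1 s') & size s' = (size s).+1].
Proof.
move=> ev conn rs us e0s; have om := ev.1.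
have [cl|[e es el]] := route_end ev rs us; last exact: route_extend el.
have [p0 [q0 j0]] := omission_joins uniH e0 om.
have [s0|sN] := eqVneq s [::].
  exists p0, [:: (e0, q0)]; rewrite s0; split=> //=.
  by rewrite (joins_endl j0) (joins_endr j0) j0.1.
have [/existsP[e /existsP[p /and3P[es pS ep]]]|N] := boolP [exists e, exists p,
    [&& e \notin unzip1 s, p \in v :: unzip2 s & ends f e p]].
  have [s1 [s2 [E l1]]] := route_split pS.
  have pe : perm_eq (unzip1 (s2 ++ s1)) (unzip1 s) by rewrite E /unzip1 !map_cat perm_catC.
  have lv : last p (unzip2 s2) = v.
    by move: cl; rewrite E /unzip2 map_cat last_cat -/unzip2 l1.
  have -> : size s = size (s2 ++ s1) by rewrite E !size_cat addnC.
  apply: (@route_extend f p (s2 ++ s1) e) => //.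
  - by move: rs; rewrite E !route_cat l1 lv andbC.
  - by rewrite (perm_uniq pe).
  - by rewrite (perm_mem pe).
  - by rewrite /unzip2 map_cat last_cat -/unzip2 lv l1.
have touch e p : p \in v :: unzip2 s -> ends f e p -> e \in unzip1 s.
  move=> pS ep; apply/negPn/negP => es; case/negP: N.
  by apply/existsP; exists e; apply/existsP; exists p; apply/and3P.
have vB : v \in comp f r.
  by move: rs sN; case: (s) => [|[e w] s'] //= /and4P[/conn].
have : connect (adj f) v p0.
  move: vB (conn _ _ (joins_endl j0)); rewrite !inE => rv; apply: connect_trans.
  by rewrite link_sym.
have closedS : closed (adj f) (mem (v :: unzip2 s)).
  apply: intro_closed; first exact: link_sym.
  move=> u w /andP[_ /existsP[e /andP[ue we]]] uS.
  exact: route_ends om rs (touch e u uS ue) we.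
move=> /(closed_connect closedS); rewrite !inE eqxx /= => /esym p0S.
by case/negP: e0s; apply: (touch e0 p0); rewrite ?inE ?p0S ?(joins_endl j0).
Qed.

Lemma connected_even_eulerian f r : even_omission f ->
  (forall e x, ends f e x -> x \in comp f r) -> 1 < #|edge H| -> eulerian H.
Proof.
move=> ev conn E2; right.
suff grow n v s : route f v s -> uniq (unzip1 s) -> #|edge H| <= size s + n ->
    exists v' s', [/\ route f v' s', uniq (unzip1 s') & forall e, e \in unzip1 s'].
  have [v [s [rs us all_s]]] := grow #|edge H| r [::] isT isT (leqnn _).
  have sz : 2 <= size s.
    apply: leq_trans E2 _; rewrite -(size_map fst) -(card_uniqP us).
    by apply: subset_leq_card; apply/subsetP => e _; apply: all_s.
  exists v, s; have ws := route_walk rs.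
  split; rewrite /trail /closed_walk ?ws ?us ?sz ?andbT //=.
    have [-> //|[e]] := route_end ev rs us; by rewrite all_s.
  by move=> e; rewrite count_uniq_mem // all_s.
elim: n v s => [|n IHn] v s rs us le; have [/existsP[e es]|] := boolP [exists e, e \notin unzip1 s].
- move: le; rewrite addn0 leqNgt -(size_map fst) -(card_uniqP us) => /negP[].
  by apply/proper_card/properP; split; [apply/subsetP | exists e].
- by rewrite negb_exists => /forallP Hs; exists v, s; split=> // e; apply/negPn.
- have [v' [s' [rs' us' sz]]] := route_grow ev conn rs us es.
  by apply: (IHn v' s') => //; rewrite sz addSn -addnS.
- by rewrite negb_exists => /forallP Hs; exists v, s; split=> // e; apply/negPn.
Qed.

End Euler.

Theorem theorem3p1 (H : hypergraph) (covH : covering3 H) (edge_ge2 : 2 <= #|edge H|) :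
  eulerian H.
Proof.
have [uniH E0 cov] := covH.
have [f [r [ev conn]]] :=
  connected_even_omission uniH cov E0 (even_omission_exists uniH cov edge_ge2).
exact: connected_even_eulerian ev conn edge_ge2.
Qed.
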